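(* Let $n\ge1$, $0<m\le L$, $\kappa=L/m$, and let $\rho\in(0,1)$ be such that $T_s=1/(1-\rho)\ge(\sqrt\kappa+1)/2$. Then the two-step momentum algorithm with parameters $$\alpha=\frac{(1+\rho)(1+\beta/\rho)}{L},\qquad \beta=\rho\,\frac{\kappa-(1+\rho)/(1-\rho)}{\kappa+(1+\rho)/(1-\rho)},\qquad\gamma=0$$ converges linearly with rate $\rho$ for all $f\in\mathcal{Q}_m^L$, and, if $T_s\le(\kappa+1)/2$, $$J_{\max}\,T_s\le\sigma_w^2\,n\kappa(\kappa+1)/2,\qquad J_{\min}\,T_s\le\sigma_w^2\,\kappa(\kappa+n-1).$$ Furthermore, for the gradient noise model ($\sigma_w=\alpha\sigma$) and any such $\rho$ (i.e. any $T_s\ge(\sqrt\kappa+1)/2$), these parameters give $$J_{\max}\,T_s\le\sigma^2\,n\kappa(\kappa+1)/L^2,\qquad J_{\min}\,T_s\le\sigma^2\,2\kappa(\kappa+4n-7)/L^2.$$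
   Context: $\mathcal{Q}_m^L$ is the class of quadratic functions $f(x)=\tfrac12x^TQx-q^Tx$ on $\mathbb{R}^n$ with $q\in\mathbb{R}^n$, $Q=Q^T\succ0$ whose largest eigenvalue is $L$ and smallest is $m$; $x^\star$ is the minimizer. The noisy two-step momentum algorithm with constant parameters $(\alpha,\beta,\gamma)$ is $x^{t+2}=x^{t+1}+\beta(x^{t+1}-x^t)-\alpha\nabla f\big(x^{t+1}+\gamma(x^{t+1}-x^t)\big)+\sigma_w w^t$, where $w^t$ is white noise with $\mathbb{E}[w^t]=0$, $\mathbb{E}[w^t(w^\tau)^T]=I\,\delta(t-\tau)$. In the iterate noise model $\sigma_w=\sigma$, in the gradient noise model $\sigma_w=\alpha\sigma$, with $\sigma>0$. With $\psi^t=[(x^t-x^\star)^T,(x^{t+1}-x^\star)^T]^T$, $\psi^{t+1}=A\psi^t+Bw^t$, $A=\begin{bmatrix}0&I\\-\beta I+\gamma\alpha Q&(1+\beta)I-(1+\gamma)\alpha Q\end{bmatrix}$, $B^T=[0\;\;\sigma_wI]$. The algorithm converges linearly with rate $\rho$ for all $f\in\mathcal{Q}_m^L$ if the spectral radius of $A$ is at most $\rho$ for every $f\in\mathcal{Q}_m^L$. Settling time $T_s=1/(1-\rho)$. Noise amplification $J=\lim_{t\to\infty}\frac1t\sum_{k=0}^t\mathbb{E}\|x^k-x^\star\|_2^2$; $J_{\max}=\max_{f\in\mathcal{Q}_m^L}J$, $J_{\min}=\min_{f\in\mathcal{Q}_m^L}J$.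
   Formalization: The two J_min bounds are stated only for n ≥ 2: for n = 1 the class is empty unless m = L, and for n = 1, m = L the gradient-noise bound equals −4σ²/L² < 0, so it fails; the J_max bounds and the convergence claim are stated for all n ≥ 1. *)

(* Defs.v *)
From HB Require Import structures.
From mathcomp Require Import all_boot all_order all_algebra.
From mathcomp Require Import all_classical all_reals all_analysis.
From mathcomp Require Import complex.
Set Implicit Arguments.
Unset Strict Implicit.
Unset Printing Implicit Defensive.
Import Order.TTheory GRing.Theory Num.Theory.
Local Open Scope ring_scope.
Local Open Scope classical_set_scope.

Section Defs.
Variable R : realType.

(* The Hessian Q of f(x) = 1/2 x^T Q x - q^T x belongs to Q_m^L:
   Q = Q^T, Q positive definite, largest eigenvalue L, smallest eigenvalue m. *)
Definition in_QmL (n : nat) (m L : R) (Q : 'M[R]_n) : Prop :=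
  [/\ Q^T = Q,
      (forall x : 'cV[R]_n, x != 0 -> 0 < (x^T *m Q *m x) 0 0),
      eigenvalue Q L /\ (forall a, eigenvalue Q a -> a <= L)
    & eigenvalue Q m /\ (forall a, eigenvalue Q a -> m <= a)].

(* gradient of f(x) = 1/2 x^T Q x - q^T x  (Q symmetric) *)
Definition gradf (n : nat) (Q : 'M[R]_n) (q : 'cV[R]_n) (x : 'cV[R]_n) : 'cV[R]_n :=
  Q *m x - q.

Definition xstar (n : nat) (Q : 'M[R]_n) (q : 'cV[R]_n) : 'cV[R]_n := invmx Q *m q.

(* The iteration matrix A of the error dynamics psi^{t+1} = A psi^t + B w^t *)
Definition Amat (n : nat) (alpha beta gamma : R) (Q : 'M[R]_n) : 'M[R]_(n + n) :=
  block_mx 0 1%:M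
           ((- beta)%:M + (gamma * alpha) *: Q) ((1 + beta)%:M - ((1 + gamma) * alpha) *: Q).

Definition spectral_radius_le (k : nat) (A : 'M[R]_k) (rho : R) : Prop :=
  forall lam : R[i], eigenvalue (map_mx (fun x : R => (x%:C)%C) A) lam ->
    `|lam| <= (rho%:C)%C.

Definition converges_linearly_QmL (n : nat) (m L alpha beta gamma rho : R) : Prop :=
  forall Q : 'M[R]_n, in_QmL m L Q -> spectral_radius_le (Amat alpha beta gamma Q) rho.

Definition white_noise d (T : measurableType d) (P : probability T R) (n : nat)
    (w : nat -> 'I_n -> T -> R) : Prop :=
  [/\ forall t i, w t i \in Lfun P 2%:E,
      forall t i, ('E_P[w t i] = 0)%E
    & forall t s i j, ('E_P[w t i \* w s j] = (((t == s) && (i == j))%:R)%:E)%E].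

(* the pair (x^k, x^{k+1}) of iterates of the noisy two-step momentum algorithm
   x^{t+2} = x^{t+1} + beta (x^{t+1} - x^t) - alpha grad f(x^{t+1} + gamma (x^{t+1} - x^t)) + sigma_w w^t,
   started at (deterministic) x^0 = x0, x^1 = x1, at sample point om *)
Fixpoint iter_pair d (T : measurableType d) (n : nat) (alpha beta gamma sigw : R)
    (Q : 'M[R]_n) (q : 'cV[R]_n) (w : nat -> 'I_n -> T -> R) (x0 x1 : 'cV[R]_n)
    (k : nat) (om : T) : 'cV[R]_n * 'cV[R]_n :=
  match k with
  | 0 => (x0, x1)
  | k'.+1 =>
      let p := iter_pair alpha beta gamma sigw Q q w x0 x1 k' om in
      let a := p.1 in let b := p.2 in
      (b, b + beta *: (b - a) - alpha *: gradf Q q (b + gamma *: (b - a))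
            + sigw *: (\col_i w k' i om))
  end.

Definition iterate d (T : measurableType d) (n : nat) (alpha beta gamma sigw : R)
    (Q : 'M[R]_n) (q : 'cV[R]_n) (w : nat -> 'I_n -> T -> R) (x0 x1 : 'cV[R]_n)
    (k : nat) (om : T) : 'cV[R]_n :=
  (iter_pair alpha beta gamma sigw Q q w x0 x1 k om).1.

Definition noise_amp d (T : measurableType d) (P : probability T R) (n : nat)
    (alpha beta gamma sigw : R) (Q : 'M[R]_n) (q : 'cV[R]_n)
    (w : nat -> 'I_n -> T -> R) (x0 x1 : 'cV[R]_n) : \bar R :=
  limn (fun t : nat =>
    ((t%:R)^-1%:E * \sum_(k < t.+1)
       'E_P[fun om => (\sum_i ((iterate alpha beta gamma sigw Q q w x0 x1 k om
                              - xstar Q q) i 0) ^+ 2)%R])%E).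

Definition Jmax d (T : measurableType d) (P : probability T R) (n : nat)
    (m L alpha beta gamma sigw : R) (w : nat -> 'I_n -> T -> R) (x0 x1 : 'cV[R]_n) : \bar R :=
  ereal_sup [set noise_amp P alpha beta gamma sigw Qq.1 Qq.2 w x0 x1
              | Qq in [set Qq : 'M[R]_n * 'cV[R]_n | in_QmL m L Qq.1]].

Definition Jmin d (T : measurableType d) (P : probability T R) (n : nat)
    (m L alpha beta gamma sigw : R) (w : nat -> 'I_n -> T -> R) (x0 x1 : 'cV[R]_n) : \bar R :=
  ereal_inf [set noise_amp P alpha beta gamma sigw Qq.1 Qq.2 w x0 x1
              | Qq in [set Qq : 'M[R]_n * 'cV[R]_n | in_QmL m L Qq.1]].

End Defs.

(* Main.v *)
Require Import Defs.
From HB Require Import structures.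
From mathcomp Require Import all_boot all_order all_algebra.
From mathcomp Require Import all_classical all_reals all_analysis.
From mathcomp Require Import complex spectral sesquilinear ring lra.
Import Order.TTheory GRing.Theory Num.Theory.
Import numFieldNormedType.Exports.
Local Open Scope ring_scope.
Local Open Scope classical_set_scope.
Set Implicit Arguments.
Unset Strict Implicit.

(** In an eigenbasis of [Q] the error splits into scalar recurrences
    [y_{k+2} = (1 + beta - alpha x) y_{k+1} - beta y_k + sigma_w e_k], one for
    each eigenvalue [x].  All of them have rate [rho] because the tuning places
    [x = m] and [x = L] on the two sides of the triangle [beta <= rho^2],
    [|1 + beta - alpha x| rho <= rho^2 + beta] in the space of coefficients of
    quadratics with roots of modulus at most [rho].  Each mode contributes its
    stationary variance to [J]; since [2 (1 + beta) = alpha (m + L)], this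
    variance is largest at [m] and [L] and smallest at [(m + L) / 2], which
    bounds [J_max], while the spectrum [m, L, (m + L) / 2, ...] bounds [J_min].
    With [c = (1 + rho) / (1 - rho)] the bounds are rational inequalities in
    [c] and [kappa] on [kappa <= c^2]. *)

(** * Stationary variance of a scalar second-order recurrence *)

Section SecondOrderRecurrence.
Variable R : realType.
Implicit Types a b s rho : R.

(** Multiplied by [rho], the gap is at least [(r - rho) * (r * rho - b)]. So [z^2 - a z + b] is
    positive at [r] and [-r], and has no real root of modulus above [rho]. *)
Lemma quadratic_pos_outside a b rho r : 0 < rho -> rho < r -> b <= rho ^+ 2 ->
  `|a| * rho <= rho ^+ 2 + b -> `|a| * r < r ^+ 2 + b.
Proof.
move=> rho0 rhor hb ha.
rewrite -(ltr_pM2l rho0); apply: (@le_lt_trans _ _ (r * (rho ^+ 2 + b))).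
  by rewrite (_ : rho * _ = r * (`|a| * rho)) ?ler_pM2l ?(lt_trans rho0) //; ring.
rewrite -subr_gt0.
rewrite (_ : _ - _ = (r - rho) * (r * rho - b)); last by ring.
rewrite mulr_gt0 ?subr_gt0 // (le_lt_trans hb) // expr2 ltr_pM2r //.
Qed.

Lemma geometric_recursion_bounded (W : nat -> R) q s : 0 <= q < 1 -> 0 <= s ->
  (forall k, W k.+1 <= q * W k + s) -> forall k, W k <= `|W 0| + s / (1 - q).
Proof.
move=> /andP[q0 q1] s0 HW; elim=> [|k IH].
  by rewrite (le_trans (ler_norm _)) // lerDl divr_ge0 // subr_ge0 ltW.
apply: (le_trans (HW k)).
apply: (@le_trans _ _ (q * (`|W 0| + s / (1 - q)) + s)).
  by rewrite lerD2r ler_wpM2l.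
have -> : q * (`|W 0| + s / (1 - q)) + s = q * `|W 0| + s / (1 - q).
  by field; rewrite subr_eq0 gt_eqF.
by rewrite lerD2r ler_piMl // ltW.
Qed.

(* [p k] and [r k] stand for the second moments [E y_k^2] and [E y_k y_{k+1}]
   of a process [y_{k+2} = a y_{k+1} - b y_k + noise] whose noise has
   variance [s]. *)
Definition second_moments a b s (p r : nat -> R) :=
  [/\ forall k, p k.+2 = a ^+ 2 * p k.+1 + b ^+ 2 * p k - 2 * a * b * r k + s,
      forall k, r k.+1 = a * p k.+1 - b * r k
    & forall k x y, 0 <= x ^+ 2 * p k.+1 + 2 * x * y * r k + y ^+ 2 * p k].

(* Lyapunov function: [W_k = E (y_{k+1} - h y_k)^2 + (q - h^2) E y_k^2], where
   [q] is the square of a rate strictly between [rho] and [1]. *)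
Lemma second_moments_bounded a b s rho (p r : nat -> R) :
  0 < rho < 1 -> b <= rho ^+ 2 -> `|a| * rho <= rho ^+ 2 + b -> 0 <= s ->
  second_moments a b s p r -> exists M, forall k, p k <= M.
Proof.
move=> /andP[rho0 rho1] hb ha s0 [Hp Hr Hpos].
pose t := (1 + rho) / 2.
have [t0 rhot t1] : [/\ 0 < t, rho < t & t < 1] by rewrite /t; split; lra.
have hat := quadratic_pos_outside rho0 rhot hb ha.
set q := t ^+ 2 in hat.
have q0 : 0 < q by rewrite exprn_gt0.
have q1 : q < 1 by rewrite exprn_ilt1 // ltW.
have bq : b < q.
  by rewrite (le_lt_trans hb) // ltr_pXn2r // nnegrE ltW.
have qb : 0 < q + b by rewrite (le_lt_trans _ hat) // mulr_ge0 // ltW.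
have qbN0 : q + b != 0 by rewrite gt_eqF.
(* This [h] makes [q * W k + s - W k.+1] a degenerate quadratic form, a multiple of
   [E (a y_{k+1} - (q + b) y_k)^2]; [hat] amounts to [|h| < t]. *)
pose h := a * q / (q + b).
have hq : h ^+ 2 < q.
  have -> : h ^+ 2 = (`|a| * t) ^+ 2 * q / (q + b) ^+ 2.
    by rewrite [in RHS]exprMn real_normK ?num_real // /h -/q; field.
  rewrite ltr_pdivrMr ?exprn_gt0 // mulrC ltr_pM2l //.
  by rewrite ltr_pXn2r // nnegrE; [apply: mulr_ge0 => //; exact: ltW|exact: ltW].
pose W k := p k.+1 + q * p k - 2 * h * r k.
have HW k : W k.+1 <= q * W k + s.
  rewrite -subr_ge0.
  have -> : q * W k + s - W k.+1 = (q - b) / (q + b) *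
     (a ^+ 2 * p k.+1 + 2 * a * (- (q + b)) * r k + (- (q + b)) ^+ 2 * p k).
    by rewrite /W Hp Hr /h; field.
  by rewrite mulr_ge0 // divr_ge0 // ?ltW // subr_gt0.
have WM := geometric_recursion_bounded (introT andP (conj (ltW q0) q1)) s0 HW.
exists ((`|W 0| + s / (1 - q)) / (q - h ^+ 2)) => k.
rewrite ler_pdivlMr ?subr_gt0 //.
apply: (le_trans _ (WM k)); rewrite -subr_ge0.
have -> : W k - p k * (q - h ^+ 2) =
   1 ^+ 2 * p k.+1 + 2 * 1 * (- h) * r k + (- h) ^+ 2 * p k.
  by rewrite /W; ring.
exact: Hpos.
Qed.

(** Stationary variance of [y_{k+2} = a y_{k+1} - b y_k + e_k] under unit white noise, the AR(2)
    variance formula. *)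
Definition stationary_gain a b :=
  (1 + b) / ((1 - b) * ((1 + b) ^+ 2 - a ^+ 2)).

Lemma cesaro_of_coboundary (p Phi : nat -> R) V M :
  (forall k, p k = V + Phi k - Phi k.+1) -> (forall k, `|Phi k| <= M) ->
  (fun t : nat => (t%:R)^-1 * \sum_(k < t.+1) p k) @ \oo --> V.
Proof.
move=> Hp HM.
have Hsum t : \sum_(k < t.+1) p k = (t.+1)%:R * V + Phi 0 - Phi t.+1.
  elim: t => [|t IH]; first by rewrite big_ord_recr big_ord0 /= Hp; ring.
  by rewrite big_ord_recr /= IH Hp -!natr1; ring.
have M0 : 0 <= M by apply: le_trans (HM 0%N).
(* The shift drops [t = 0], where the inverse is the default [0]. Dividing [t.+2] terms by [t.+1]
   leaves an extra [V] in the vanishing remainder. *)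
rewrite -cvg_shiftS /=.
have -> : (fun t : nat => (t.+1%:R)^-1 * \sum_(k < t.+2) p k) =
    (fun t : nat => V + (t.+1%:R)^-1 * (V + Phi 0 - Phi t.+2)).
  apply/funext => t; rewrite Hsum -(natr1 t.+1).
  have : t.+1%:R != 0 :> R by rewrite pnatr_eq0.
  by move: (t.+1%:R : R) => x x0; field.
suff H0 : (fun t : nat => (t.+1%:R)^-1 * (V + Phi 0 - Phi t.+2)) @ \oo --> (0 : R).
  by have := cvgD (cvg_cst V) H0; rewrite addr0; exact.
have Hb : (fun t : nat => harmonic t * (`|V| + M + M)) @ \oo --> (0 : R).
  have := cvgM (@cvg_harmonic R) (cvg_cst (`|V| + M + M)).
  by rewrite mul0r; exact.
apply/norm_cvg0P/(squeeze_cvgr _ (cvg_cst 0) Hb); near=> t.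
rewrite normr_ge0 /= normrM ger0_norm ?invr_ge0 //.
rewrite ler_wpM2l ?invr_ge0 // (le_trans (ler_normB _ _)) // lerD //.
by rewrite (le_trans (ler_normD _ _)) // lerD.
Unshelve. all: by end_near.
Qed.

(* The Poisson equation of the recurrence, [p_k = V + Phi_k - Phi_{k+1}] with
   [Phi] a bounded quadratic form in [(y_k, y_{k+1})], makes the averages
   telescope. *)
Lemma second_moments_cesaro a b s rho (p r : nat -> R) :
  0 < rho < 1 -> b <= rho ^+ 2 -> `|a| * rho <= rho ^+ 2 + b -> 0 <= s ->
  second_moments a b s p r ->
  (fun t : nat => (t%:R)^-1 * \sum_(k < t.+1) p k) @ \oo -->
    stationary_gain a b * s.
Proof.
move=> /[dup] rho01 /andP[rho0 rho1] hb ha s0 H.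
have [M HM] := second_moments_bounded rho01 hb ha s0 H.
have ha1 := quadratic_pos_outside rho0 rho1 hb ha.
rewrite mulr1 expr1n in ha1.
have b1 : b < 1 by rewrite (le_lt_trans hb) // exprn_ilt1 // ltW.
have b1N : 1 - b != 0 by rewrite subr_eq0 gt_eqF.
have b0 : 0 < 1 + b by rewrite (le_lt_trans _ ha1).
have b0N : 1 + b != 0 by rewrite gt_eqF.
have abN : (1 + b) ^+ 2 - a ^+ 2 != 0.
  rewrite subr_eq0 gt_eqF // -[a ^+ 2]real_normK ?num_real //.
  by rewrite ltr_pXn2r // nnegrE // ltW.
have [Hp Hr Hpos] := H.
(* In the Poisson equation the coefficients of [p k] and [r k] fix [B] and [C] from [A]; that of
   [p k.+1] then forces [A] to be the stationary gain. *)
pose A := stationary_gain a b.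
pose B := 1 + A * b ^+ 2.
pose C := - 2 * A * a * b / (1 + b).
pose Phi k := A * p k.+1 + B * p k + C * r k.
have p0 k : 0 <= p k.
  by have := Hpos k 0 1; rewrite !expr2 !(mulr0, mul0r, mul1r, add0r).
(* The choices [(1, 1)] and [(1, -1)] in [Hpos] bound [2 |r k|] by [p k + p k.+1]. *)
have rM k : `|r k| <= M.
  have := Hpos k 1 1; have := Hpos k 1 (-1).
  have := HM k; have := HM k.+1.
  by rewrite ler_norml => *; apply/andP; split; lra.
apply: (@cesaro_of_coboundary p Phi _ (`|A| * M + `|B| * M + `|C| * M)).
  move=> k; rewrite /Phi /B /C Hp Hr /A /stationary_gain; field.
  by rewrite abN b1N b0N.
move=> k; rewrite /Phi (le_trans (ler_normD _ _)) // lerD //; last first.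
  by rewrite normrM ler_wpM2l.
by rewrite (le_trans (ler_normD _ _)) // lerD // normrM ler_wpM2l // ger0_norm.
Qed.

End SecondOrderRecurrence.

(** * Eigenvector frames of symmetric matrices and the spectral radius of [Amat] *)

Section SpectralFrame.
Variable R : realType.
Local Notation toC := (fun x : R => (x%:C)%C).
Local Notation cRe := (@complex.Re R).
Local Notation cIm := (@complex.Im R).

Lemma Re_sum (I : finType) (F : I -> R[i]) : cRe (\sum_i F i) = \sum_i cRe (F i).
Proof. by apply: big_morph => // -[? ?] [? ?]. Qed.

Lemma Im_sum (I : finType) (F : I -> R[i]) : cIm (\sum_i F i) = \sum_i cIm (F i).
Proof. by apply: big_morph => // -[? ?] [? ?]. Qed.

Lemma real_sym_hermsym n (Q : 'M[R]_n) : Q^T = Q -> map_mx toC Q \is hermsymmx.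
Proof.
move=> QT; apply: realsym_hermsym.
  apply/is_hermitianmxP; rewrite expr0 scale1r; apply/matrixP => i j.
  by rewrite !mxE -[in LHS]QT mxE.
by apply/mxOverP => i j; rewrite mxE; apply/complex_realP; exists (Q i j).
Qed.

(** In unitary eigencoordinates an eigenvector has a nonzero entry, and the diagonal value there,
    real for a Hermitian matrix, is [z]. This links the complex spectrum of [Amat] to the real
    eigenvalues in [in_QmL]. *)
Lemma complex_eigenvalue_sym n (Q : 'M[R]_n) (z : R[i]) : Q^T = Q ->
  eigenvalue (map_mx toC Q) z -> exists2 x : R, z = (x%:C)%C & eigenvalue Q x.
Proof.
move=> QT ez.
have herm := real_sym_hermsym QT.
have /hermitian_normalmx /orthomx_spectralP QE := herm.
have /mxOverP Dreal := hermitian_spectral_diag_real herm.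
set P := spectralmx _ in QE; set D := spectral_diag _ in QE Dreal.
have Pu : P \in unitmx := spectral_unit _.
have zR : z \is Num.real.
  have /eigenvalueP [v vz v0] := ez.
  have : v *m invmx P *m diag_mx D = z *: (v *m invmx P).
    by rewrite scalemxAl -vz [in RHS]QE !mulmxA mulmxK.
  have : v *m invmx P != 0.
    by apply: contra_neq v0 => vP0; rewrite -[v](mulmxKV Pu) vP0 mul0mx.
  move/rV0Pn => [j uj0] /rowP /(_ j); rewrite mul_mx_diag !mxE => /eqP.
  rewrite mulrC (inj_eq (mulIf _)); last by move: uj0; rewrite !mxE.
  by move/eqP <-; exact: Dreal.
case/complex_realP: zR => x zx; exists x => //.
by rewrite -(eigenvalue_map (@real_complex_def R (Phant R))) /= -zx.
Qed.

(** The last clause is Parseval's identity. Rows may be dependent or zero, so the second clause does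
    not follow from the first. *)
Definition eigenframe n N (Q : 'M[R]_n) (U : 'M[R]_(N, n)) (D : 'I_N -> R) :=
  [/\ forall l, row l U *m Q = D l *: row l U,
      forall l, eigenvalue Q (D l)
    & U^T *m U = 1%:M].

(* The real and imaginary parts of the rows of a unitary diagonalisation:
   a Parseval frame of eigenvectors, which serves as well as an orthonormal
   eigenbasis of [Q]. *)
Lemma sym_eigenframe n (Q : 'M[R]_n) : Q^T = Q ->
  exists N (U : 'M[R]_(N, n)) (D : 'I_N -> R), eigenframe Q U D.
Proof.
move=> QT.
have herm := real_sym_hermsym QT.
have /hermitian_normalmx /orthomx_spectralP QE := herm.
have /mxOverP Dreal := hermitian_spectral_diag_real herm.
have Pu := spectral_unitarymx (map_mx toC Q).
have Pi := spectral_unit (map_mx toC Q).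
set P := spectralmx _ in QE Pu Pi; set D := spectral_diag _ in QE Dreal.
have De i : eigenvalue Q (cRe (D 0 i)).
  rewrite -(eigenvalue_map (@real_complex_def R (Phant R))) /= RRe_real //.
  apply/eigenvalueP; exists (row i P).
    rewrite -row_mul [X in P *m X]QE -mulmxA mulKVmx //; apply/rowP => k.
    by rewrite mxE mul_diag_mx !mxE.
  apply/negP => /eqP /(congr1 (fun u => (u *m invmx P) 0 i)).
  by rewrite -row_mul mulmxV // mul0mx !mxE eqxx => /eqP; rewrite oner_eq0.
have PQ i k : \sum_j P i j * (Q j k)%:C%C = (cRe (D 0 i))%:C%C * P i k.
  have /matrixP/(_ i k) : P *m map_mx toC Q = diag_mx D *m P.
    by rewrite [X in P *m X]QE -mulmxA mulKVmx.
  rewrite mul_diag_mx !mxE => H.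
  by rewrite RRe_real // -[RHS]H; apply: eq_bigr => j _; rewrite !mxE.
have PP i k : \sum_j (P j i)^* * P j k = (i == k)%:R.
  have /matrixP/(_ i k) : (map_mx Num.conj P^T) *m P = 1%:M.
    by rewrite -invmx_unitary // mulVmx.
  by rewrite !mxE => <-; apply: eq_bigr => j _; rewrite !mxE.
exists (n + n)%N, (col_mx (map_mx cRe P) (map_mx cIm P)),
  (fun l => match fintype.split l with inl i | inr i => cRe (D 0 i) end); split.
- move=> l; case: split_ordP => i ->; rewrite ?rowKu ?rowKd; apply/rowP => k.
  + have /(congr1 cRe) := PQ i k; rewrite Re_sum !mxE => H.
    have -> : cRe (D 0 i) * cRe (P i k) = cRe ((cRe (D 0 i))%:C%C * P i k).
      by case: (P i k) => x y /=; rewrite mul0r subr0.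
    rewrite -H; apply: eq_bigr => j _; rewrite !mxE.
    by case: (P i j) => x y /=; rewrite mulr0 subr0.
  + have /(congr1 cIm) := PQ i k; rewrite Im_sum !mxE => H.
    have -> : cRe (D 0 i) * cIm (P i k) = cIm ((cRe (D 0 i))%:C%C * P i k).
      by case: (P i k) => x y /=; rewrite mul0r addr0.
    rewrite -H; apply: eq_bigr => j _; rewrite !mxE.
    by case: (P i j) => x y /=; rewrite mulr0 add0r.
- by move=> l; case: split_ordP => i _; exact: De.
(* The real part of [P^* P = 1] is the sum of the Gram matrices of [Re P] and [Im P]. *)
- rewrite tr_col_mx mul_row_col; apply/matrixP => i k.
  have /(congr1 cRe) := PP i k; rewrite Re_sum !mxE => H.
  have -> : (i == k)%:R = cRe (i == k)%:R :> R by case: (i == k).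
  rewrite -H -big_split; apply: eq_bigr => j _; rewrite !mxE /=.
  by case: (P j i) (P j k) => x y [x' y'] /=; rewrite mulNr opprK.
Qed.

(** A non-real root has its conjugate as the other root, so its squared modulus is [b]; a real root
    beyond [rho] contradicts [quadratic_pos_outside]. *)
Lemma complex_root_norm_le (a b rho : R) (z : R[i]) : 0 < rho ->
  b <= rho ^+ 2 -> `|a| * rho <= rho ^+ 2 + b ->
  z ^+ 2 - (a%:C)%C * z + (b%:C)%C = 0 -> `|z| <= (rho%:C)%C.
Proof.
case: z => x y rho0 hb ha /eqP; rewrite expr2 eq_complex /= => /andP[/eqP + /eqP].
rewrite normc_def lecR /= => eRe eIm.
rewrite -[leRHS](gtr0_norm rho0) -sqrtr_sqr ler_sqrt ?sqr_ge0 //.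
have [y0|yN0] := eqVneq y 0; last first.
  have aE : a = 2 * x.
    apply: (mulIf yN0); lra.
  by move: eRe; rewrite aE; nra.
rewrite y0 expr0n addr0 -[x ^+ 2]real_normK ?num_real //.
rewrite ler_pXn2r ?nnegrE ?(ltW rho0) //.
rewrite leNgt; apply/negP => rhox.
have := quadratic_pos_outside rho0 rhox hb ha.
rewrite -normrM real_normK ?num_real // ltNge; move/negP; apply.
apply: le_trans (ler_norm _); move: eRe; rewrite y0; lra.
Qed.

(** Eliminating [v1] from a left eigenvector [(v1, v2)] makes [v2] an eigenvector of [Q], whose
    eigenvalue [mu] satisfies [z^2 - (1 + beta - alpha mu) z + beta = 0]. Solving for [mu] divides
    by [alpha z], hence the separate case [z = 0]. *)
Lemma momentum_spectral_radius_le n (alpha beta rho : R) (Q : 'M[R]_n) :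
  Q^T = Q -> 0 < rho -> alpha != 0 -> beta <= rho ^+ 2 ->
  (forall x, eigenvalue Q x ->
     `|1 + beta - alpha * x| * rho <= rho ^+ 2 + beta) ->
  spectral_radius_le (Amat alpha beta 0 Q) rho.
Proof.
move=> QT rho0 alpha0 hb hQ z /eigenvalueP [v vz v0].
have [->|z0] := eqVneq z 0; first by rewrite normr0 ler0c ltW.
rewrite -[v]hsubmxK in vz v0.
move: (lsubmx v) (rsubmx v) vz v0 => v1 v2.
rewrite /Amat map_block_mx mul_row_block scale_row_mx => /eq_row_mx [].
rewrite mul0r scale0r addr0 addr0 mul1r map_mx0 map_mx1 map_mxB map_mxZ.
rewrite !map_scalar_mx /= mulmx0 add0r mulmx1 mulmxBr !mul_mx_scalar.
rewrite -scalemxAr => E1 E2 v0.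
have alphaC0 : (alpha%:C)%C != 0 :> R[i] by rewrite eq_complex /= eqxx andbT.
have v20 : v2 != 0.
  apply: contra_neq v0 => v20; move: E1; rewrite v20 scaler0 => /esym/eqP.
  by rewrite scaler_eq0 (negbTE z0) /= => /eqP ->; rewrite row_mx0.
pose mu := (((1 + beta)%:C)%C * z - (beta%:C)%C - z ^+ 2) / ((alpha%:C)%C * z).
have ev : eigenvalue (map_mx toC Q) mu.
  apply/eigenvalueP; exists v2 => //.
  have : (alpha%:C)%C *: (v2 *m map_mx toC Q) =
      v1 + ((1 + beta)%:C)%C *: v2 - z *: v2.
    by rewrite -E2 addrA opprB [RHS]addrC subrK.
  move/(congr1 (fun u => z *: u)); rewrite scalerBr scalerDr -E1 !scalerA.
  rewrite -scalerDl -scalerBl => H.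
  apply: (scalerI (mulf_neq0 z0 alphaC0)); rewrite H scalerA; congr (_ *: _).
  rewrite /mu raddfN /=; field; rewrite z0 //.
have [x mux ex] := complex_eigenvalue_sym QT ev.
apply: (complex_root_norm_le rho0 hb (hQ x ex)).
have : mu * ((alpha%:C)%C * z) =
  ((1 + beta)%:C)%C * z - (beta%:C)%C - z ^+ 2 by rewrite /mu divfK ?mulf_neq0.
rewrite mux => H.
have -> : ((1 + beta - alpha * x)%:C)%C = (((1 + beta)%:C)%C - (alpha%:C)%C * (x%:C)%C) :> R[i].
  by rewrite rmorphB rmorphM.
rewrite mulrBl -[_ * _ * z]mulrA [_ * (_ * z)]mulrCA H; ring.
Qed.

End SpectralFrame.

(** * Inner products of square-integrable random variables *)

Section L2InnerProduct.
Context (R : realType) (d : measure_display) (T : measurableType d).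
Variable P : probability T R.
Implicit Types f g h : T -> R.

(** [fine] sends an infinite expectation to [0], so the linearity laws ask for square
    integrability. *)
Definition L2ip f g : R := fine ('E_P[f \* g])%E.

Lemma EFin_L2ip f g : f \in Lfun P 2%:E -> g \in Lfun P 2%:E ->
  (L2ip f g)%:E = ('E_P[f \* g])%E.
Proof. by move=> Hf Hg; rewrite fineK // expectation_fin_num // Lfun2_mul_Lfun1. Qed.

Lemma L2ipC f g : L2ip f g = L2ip g f.
Proof. by congr (fine (expectation _ _)); apply/funext => x /=; rewrite mulrC. Qed.

Lemma Lfun2_lin f g a b : f \in Lfun P 2%:E -> g \in Lfun P 2%:E ->
  (fun x => a * f x + b * g x) \in Lfun P 2%:E.
Proof.
move=> Hf Hg.
rewrite (_ : (fun x => _) = (a *: f + b *: g)); last by [].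
have [L0 L] := Lfun_submod_closed P (lee1n 2).
by apply: (L) => //; rewrite -[b *: g]addr0; exact: L.
Qed.

Lemma L2ip_linl a b f g h :
  f \in Lfun P 2%:E -> g \in Lfun P 2%:E -> h \in Lfun P 2%:E ->
  L2ip (fun x => a * f x + b * g x) h = a * L2ip f h + b * L2ip g h.
Proof.
move=> Hf Hg Hh.
have Hfh := Lfun2_mul_Lfun1 Hf Hh; have Hgh := Lfun2_mul_Lfun1 Hg Hh.
rewrite /L2ip.
rewrite (_ : _ \* _ = (a \o* (f \* h)) \+ (b \o* (g \* h))); last first.
  by apply/funext => x /=; ring.
rewrite expectationD ?Lfun_scale // !expectationZl //.
by rewrite fineD ?fineM ?fin_numM ?expectation_fin_num.
Qed.

Lemma L2ip_linr a b f g h :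
  f \in Lfun P 2%:E -> g \in Lfun P 2%:E -> h \in Lfun P 2%:E ->
  L2ip h (fun x => a * f x + b * g x) = a * L2ip h f + b * L2ip h g.
Proof. by move=> *; rewrite L2ipC L2ip_linl // !(L2ipC h). Qed.

Lemma L2ip_ge0 f : 0 <= L2ip f f.
Proof. by rewrite fine_ge0 // expectation_ge0 // => x; rewrite /= -expr2 sqr_ge0. Qed.

Lemma Lfun2_sum (I : Type) (r : seq I) (c : I -> R) (F : I -> T -> R) :
  (forall i, F i \in Lfun P 2%:E) ->
  (fun x => \sum_(i <- r) c i * F i x) \in Lfun P 2%:E.
Proof.
move=> HF; elim: r => [|i r IH].
  by under eq_fun do rewrite big_nil; exact: Lfun_cst.
under eq_fun do rewrite big_cons.
have := Lfun2_lin (c i) 1 (HF i) IH.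
by under eq_fun do rewrite mul1r.
Qed.

Lemma L2ip_suml (I : Type) (r : seq I) (c : I -> R) (F : I -> T -> R) h :
  (forall i, F i \in Lfun P 2%:E) -> h \in Lfun P 2%:E ->
  L2ip (fun x => \sum_(i <- r) c i * F i x) h = \sum_(i <- r) c i * L2ip (F i) h.
Proof.
move=> HF Hh; elim: r => [|i r IH].
  rewrite big_nil /L2ip (_ : _ \* _ = cst 0) ?expectation_cst //.
  by apply/funext => x /=; rewrite big_nil mul0r.
rewrite big_cons -IH -[X in _ + X]mul1r -L2ip_linl //; last exact: Lfun2_sum.
by congr L2ip; apply/funext => x; rewrite big_cons mul1r.
Qed.

Lemma L2ip_sumr (I : Type) (r : seq I) (c : I -> R) (F : I -> T -> R) h :
  (forall i, F i \in Lfun P 2%:E) -> h \in Lfun P 2%:E ->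
  L2ip h (fun x => \sum_(i <- r) c i * F i x) = \sum_(i <- r) c i * L2ip h (F i).
Proof.
move=> HF Hh; rewrite L2ipC L2ip_suml //.
by apply: eq_bigr => i _; rewrite L2ipC.
Qed.

Lemma L2ip_cstl c h : h \in Lfun P 2%:E ->
  L2ip (cst c) h = c * fine ('E_P[h])%E.
Proof.
move=> Hh; rewrite /L2ip (_ : _ \* _ = c \o* h); last first.
  by apply/funext => x /=; rewrite mulrC.
have L1h : h \in Lfun P 1 by apply: Lfun_subset12 => //; exact: fin_num_measure.
by rewrite expectationZl // fineM // expectation_fin_num.
Qed.

Lemma expectation_sum_sqr (I : Type) (r : seq I) (F : I -> T -> R) :
  (forall i, F i \in Lfun P 2%:E) ->
  ('E_P[fun x => (\sum_(i <- r) F i x ^+ 2)%R] = (\sum_(i <- r) L2ip (F i) (F i))%:E)%E.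
Proof.
move=> HF.
(* Integrability of the partial sums is carried along, as additivity of the expectation asks for
   it. *)
suff [_ ->] : (fun x => (\sum_(i <- r) F i x ^+ 2)%R) \in Lfun P 1 /\
  ('E_P[fun x => (\sum_(i <- r) F i x ^+ 2)%R] = (\sum_(i <- r) L2ip (F i) (F i))%:E)%E by [].
elim: r => [|i r [IH1 IH2]].
  rewrite big_nil (_ : (fun _ => _) = cst 0) ?expectation_cst; last first.
    by apply/funext => x; rewrite big_nil.
  by split => //; exact: Lfun_cst.
rewrite (_ : (fun _ => _) = (F i \* F i) \+ (fun x => \sum_(j <- r) F j x ^+ 2));
  last by apply/funext => x /=; rewrite big_cons expr2.
have H1 := Lfun2_mul_Lfun1 (HF i) (HF i).
split; last by rewrite expectationD // IH2 -EFin_L2ip // -EFinD big_cons.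
by have [_ L] := Lfun_addr_closed P (lexx 1%E); exact: L.
Qed.

(* A process driven by white noise: [y k] depends only on the noise before
   time [k.-1], hence is orthogonal to the noise from time [k.-1] on. *)
Lemma noisy_recurrence_moments (a b s v : R) (y e : nat -> T -> R) (y0 y1 : R) :
  y 0%N = cst y0 -> y 1%N = cst y1 ->
  (forall k x, y k.+2 x = a * y k.+1 x - b * y k x + s * e k x) ->
  (forall k, e k \in Lfun P 2%:E) -> (forall k, fine ('E_P[e k])%E = 0) ->
  (forall k l, L2ip (e k) (e l) = (k == l)%:R * v) ->
  (forall k, y k \in Lfun P 2%:E) /\
  second_moments a b (s ^+ 2 * v) (fun k => L2ip (y k) (y k))
    (fun k => L2ip (y k) (y k.+1)).
Proof.
move=> y0E y1E yS eL e0 ee.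
have yE k : y k.+2 = (fun x => 1 * (a * y k.+1 x + (- b) * y k x) + s * e k x).
  by apply/funext => x; rewrite yS mul1r mulNr.
have yL k : y k \in Lfun P 2%:E /\ y k.+1 \in Lfun P 2%:E.
  elim: k => [|k [IH1 IH2]]; first by rewrite y0E y1E; split; exact: Lfun_cst.
  by split => //; rewrite yE; do 2?apply: Lfun2_lin.
have {}yL k : y k \in Lfun P 2%:E by case: (yL k).
have yye k h : h \in Lfun P 2%:E ->
    L2ip (y k.+2) h = a * L2ip (y k.+1) h - b * L2ip (y k) h + s * L2ip (e k) h.
  move=> hL; rewrite yE L2ip_linl ?L2ip_linl ?mul1r ?mulNr //.
  exact: Lfun2_lin.
have ye k l : (k <= l.+1)%N -> L2ip (y k) (e l) = 0.
  (* A second-order recurrence needs the claim at two consecutive indices. *)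
  suff : ((k <= l.+1)%N -> L2ip (y k) (e l) = 0) /\
         ((k < l.+1)%N -> L2ip (y k.+1) (e l) = 0) by case.
  elim: k => [|k [IH1 IH2]].
    by rewrite y0E y1E !L2ip_cstl // e0 !mulr0.
  split => // kl; rewrite yye // IH2 ?(ltnW kl) // IH1 ?ee; last first.
    by rewrite ltnW // ltnW.
  by rewrite ltn_eqF // mul0r !mulr0 subrr addr0.
split=> //; split=> [k|k|k x x'].
- rewrite yye // !(L2ipC _ (y k.+2)) !yye // (L2ipC (e k) (y k.+1)).
  rewrite (L2ipC (e k) (y k)) (L2ipC (y k.+1) (y k)) !ye // ee eqxx mul1r.
  by ring.
- by rewrite L2ipC yye // [L2ip (e k) _]L2ipC ye //; ring.
- have := L2ip_ge0 (fun t => x * y k.+1 t + x' * y k t).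
  have L := Lfun2_lin x x' (yL k.+1) (yL k).
  rewrite L2ip_linl // !L2ip_linr // [L2ip (y k.+1) (y k)]L2ipC.
  by congr (_ <= _); ring.
Qed.

End L2InnerProduct.

(** * Noise amplification as a sum of modal gains *)

Section NoiseAmplification.
Context (R : realType) (d : measure_display) (T : measurableType d).
Variables (P : probability T R) (n : nat) (w : nat -> 'I_n -> T -> R).
Hypothesis wn : white_noise P w.

(** Projected on [u], isotropic white noise becomes scalar white noise of variance [|u|^2]. This is
    the weight of the mode in [J], as frame vectors need not have norm one. *)
Lemma white_noise_comb (u : 'I_n -> R) :
  let e k x := \sum_i u i * w k i x in
  [/\ forall k, e k \in Lfun P 2%:E, forall k, fine ('E_P[e k])%E = 0 &
      forall k l, L2ip P (e k) (e l) = (k == l)%:R * \sum_i u i ^+ 2].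
Proof.
case: wn => wL w0 ww e.
have eL k : e k \in Lfun P 2%:E by exact: Lfun2_sum.
split=> // [k|k l].
  rewrite -[LHS]mul1r -L2ip_cstl // L2ip_sumr //; last exact: Lfun_cst.
  by rewrite big1 // => i _; rewrite L2ip_cstl // w0 !mulr0.
rewrite L2ip_suml // mulr_sumr; apply: eq_bigr => i _.
rewrite L2ip_sumr // (bigD1 i) //= big1 ?addr0 => [|j ji].
  by rewrite /L2ip ww eqxx andbT /=; ring.
by rewrite /L2ip ww [i == j]eq_sym (negbTE ji) andbF /= mulr0.
Qed.

Variables (alpha beta sigw : R) (Q : 'M[R]_n) (q x0 x1 : 'cV[R]_n).
Hypothesis Qu : Q \in unitmx.

Let z k om := iterate alpha beta 0 sigw Q q w x0 x1 k om - xstar Q q.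

Lemma error_recurrence k om :
  z k.+2 om = (1 + beta) *: z k.+1 om - alpha *: (Q *m z k.+1 om)
    - beta *: z k om + sigw *: \col_i w k i om.
Proof.
rewrite /z /iterate /= /gradf scale0r addr0 mulmxBr mulKVmx //.
move: (iter_pair _ _ _ _ _ _ _ _ _ _ _) => [a b] /=.
set s := sigw *: _; set qx := Q *m b - q.
by apply/colP => i; rewrite !mxE; ring.
Qed.

(** By Parseval the squared error is the sum of the squared modes, so correlations between modes do
    not enter; each modal average converges by [second_moments_cesaro]. *)
Lemma noise_amp_eigenframe N (U : 'M[R]_(N, n)) (D : 'I_N -> R) rho :
  eigenframe Q U D -> 0 < rho < 1 -> beta <= rho ^+ 2 ->
  (forall l, `|1 + beta - alpha * D l| * rho <= rho ^+ 2 + beta) ->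
  noise_amp P alpha beta 0 sigw Q q w x0 x1 =
  (\sum_l stationary_gain (1 + beta - alpha * D l) beta *
     (sigw ^+ 2 * \sum_i U l i ^+ 2))%:E.
Proof.
move=> [UQ _ UU] rho01 hb hD.
pose y l k om := (U *m z k om) l 0.
have yS l k om : y l k.+2 om = (1 + beta - alpha * D l) * y l k.+1 om
    - beta * y l k om + sigw * \sum_i U l i * w k i om.
  rewrite /y error_recurrence.
  move: (z k.+1 om) (z k om) => z1 z0; rewrite mulmxDr !mulmxBr -!scalemxAr.
  have -> : U *m \col_i w k i om = \col_l0 \sum_i U l0 i * w k i om.
    by apply/colP => l0; rewrite !mxE; apply: eq_bigr => i _; rewrite !mxE.
  have : (U *m (Q *m z1)) l 0 = D l * (U *m z1) l 0.
    have rE (A : 'cV[R]_N) : A l 0 = row l A 0 0 by rewrite mxE.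
    have /(congr1 (fun u => (u *m z1) 0 0)) := UQ l.
    by rewrite -scalemxAl -!row_mul -mulmxA [RHS]mxE -!rE.
  move: (U *m (Q *m _)) (U *m z1) (U *m z0) => A1 A2 A3 A1E.
  by rewrite !mxE A1E; ring.
have zy k om : \sum_i (z k om) i 0 ^+ 2 = \sum_l y l k om ^+ 2.
  have sq m (v : 'cV[R]_m) : \sum_i v i 0 ^+ 2 = (v^T *m v) 0 0.
    by rewrite mxE; apply: eq_bigr => i _; rewrite mxE expr2.
  by rewrite /y !sq trmx_mul -mulmxA (mulmxA U^T) UU mul1mx.
pose p l k := L2ip P (y l k) (y l k).
have yL l : (forall k, y l k \in Lfun P 2%:E) /\
    second_moments (1 + beta - alpha * D l) beta
      (sigw ^+ 2 * \sum_i U l i ^+ 2) (p l)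
      (fun k => L2ip P (y l k) (y l k.+1)).
  have [eL e0 ee] := white_noise_comb (U l).
  exact: (@noisy_recurrence_moments _ _ _ P _ _ sigw _ (y l) _
    ((U *m (x0 - xstar Q q)) l 0) ((U *m (x1 - xstar Q q)) l 0)
    _ _ (yS l) eL e0 ee).
have cv : (fun t : nat => \sum_l (t%:R^-1 * \sum_(k < t.+1) p l k)) @ \oo -->
   \sum_l stationary_gain (1 + beta - alpha * D l) beta *
     (sigw ^+ 2 * \sum_i U l i ^+ 2).
  apply: (cvg_big add_continuous) => l _; apply: (second_moments_cesaro rho01 hb (hD l) _ (yL l).2).
  by rewrite mulr_ge0 ?sqr_ge0 // sumr_ge0 // => i _; rewrite sqr_ge0.
rewrite /noise_amp; apply: cvg_lim => //.
rewrite (_ : (fun t => _) =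
  EFin \o (fun t : nat => \sum_l (t%:R^-1 * \sum_(k < t.+1) p l k))).
  by apply/fine_cvgP; split; [exact: nearW|exact: cv].
apply/funext => t /=.
rewrite -mulr_sumr exchange_big EFinM -sumEFin; congr (_ * _)%E.
apply: eq_bigr => k _; under eq_fun do rewrite zy.
by rewrite expectation_sum_sqr // => l; exact: (yL l).1.
Qed.
End NoiseAmplification.

(** * The tuning in the variables [k = L / m] and [c = (1 + rho) / (1 - rho)] *)

Section Tuning.
Variables (R : realType) (m k c : R).
Hypotheses (m0 : 0 < m) (k1 : 1 <= k) (c1 : 1 < c) (kc : k <= c ^+ 2).
Let L := k * m.
Let rho := (c - 1) / (c + 1).
Let beta := (c - 1) * (k - c) / ((c + 1) * (k + c)).
Let alpha := 4 * c / ((c + 1) * (k + c) * m).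
Let Ts := (c + 1) / 2.

Let c0 : 0 < c. Proof. exact: lt_trans c1. Qed.
Let k0 : 0 < k. Proof. exact: lt_le_trans k1. Qed.
Let kc0 : 0 < k + c ^+ 2. Proof. by rewrite addr_gt0 ?exprn_gt0. Qed.
Let c0N : c != 0. Proof. by rewrite gt_eqF. Qed.
Let k0N : k != 0. Proof. by rewrite gt_eqF. Qed.
Let m0N : m != 0. Proof. by rewrite gt_eqF. Qed.
Let k1N : k + 1 != 0. Proof. by rewrite gt_eqF // addr_gt0. Qed.
Let c1N : c + 1 != 0. Proof. by rewrite gt_eqF // addr_gt0. Qed.
Let kcN : k + c != 0. Proof. by rewrite gt_eqF // addr_gt0. Qed.
Let kc2N : k + c ^+ 2 != 0. Proof. by rewrite gt_eqF. Qed.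

Lemma tuning_rho01 : 0 < rho < 1.
Proof.
apply/andP; split; first by apply: divr_gt0; move: c1; lra.
by rewrite ltr_pdivrMr; move: c1; lra.
Qed.

Lemma tuning_alpha_gt0 : 0 < alpha.
Proof. by rewrite divr_gt0 ?mulr_gt0 ?addr_gt0. Qed.

Lemma tuning_1Dbeta : 1 + beta = 2 * c * (k + 1) / ((c + 1) * (k + c)).
Proof. by rewrite /beta; field; rewrite c1N kcN. Qed.

Lemma tuning_1Bbeta : 1 - beta = 2 * (k + c ^+ 2) / ((c + 1) * (k + c)).
Proof. by rewrite /beta; field; rewrite c1N kcN. Qed.

(** The difference is a positive multiple of [c ^+ 2 - k]: the lower bound on the settling time is
    exactly this edge of the stability triangle. *)
Lemma tuning_beta_le : beta <= rho ^+ 2.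
Proof.
rewrite -subr_ge0.
have -> : rho ^+ 2 - beta = 2 * (c - 1) * (c ^+ 2 - k) / ((c + 1) ^+ 2 * (k + c)).
  by rewrite /rho /beta; field; rewrite c1N kcN.
rewrite divr_ge0 //.
  by rewrite !mulr_ge0 // subr_ge0 // ltW.
by rewrite mulr_ge0 ?sqr_ge0 // addr_ge0 // ltW.
Qed.

(** The slacks are [rho * alpha * (L - x)] and [rho * alpha * (x - m)]: the end eigenvalues lie on
    the two slanted edges of the triangle. *)
Lemma tuning_stable x : m <= x <= L ->
  `|1 + beta - alpha * x| * rho <= rho ^+ 2 + beta.
Proof.
move=> /andP[mx xL].
have /andP[rho0 _] := tuning_rho01.
have ra0 : 0 < rho * alpha by rewrite mulr_gt0 ?tuning_alpha_gt0.
have H1 : 0 <= rho * alpha * (x - m) by rewrite mulr_ge0 ?subr_ge0 // ltW.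
have H2 : 0 <= rho * alpha * (L - x) by rewrite mulr_ge0 ?subr_ge0 // ltW.
rewrite -[rho in X in X <= _](gtr0_norm rho0) -normrM ler_norml.
apply/andP; split; rewrite -subr_ge0.
  rewrite [leRHS](_ : _ = rho * alpha * (L - x)) //.
  by rewrite /rho /alpha /beta /L; field; rewrite c1N kcN m0N.
rewrite [leRHS](_ : _ = rho * alpha * (x - m)) //.
by rewrite /rho /alpha /beta /L; field; rewrite c1N kcN m0N.
Qed.

Let gain x := stationary_gain (1 + beta - alpha * x) beta.

(** Value of [gain] at [m] and at [L]; [m] cancels since [alpha] scales as [1 / m]. *)
Definition extreme_gain :=
  (k + 1) * (c + 1) ^+ 2 * (k + c) ^+ 2 / (16 * c * k * (k + c ^+ 2)).

(** Value of [gain] at [(m + L) / 2], its minimum over the spectrum. *)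
Definition middle_gain :=
  (c + 1) ^+ 2 * (k + c) ^+ 2 / (4 * c * (k + 1) * (k + c ^+ 2)).

(* The tuning satisfies [2 (1 + beta) = alpha (m + L)]: the gain is symmetric
   about the midpoint of the spectrum, and its denominator is a concave
   parabola smallest at [m] and [L]. *)
Lemma tuning_gainE x : x != 0 -> m + L - x != 0 ->
  gain x = extreme_gain * (m * L) / (x * (m + L - x)).
Proof.
move=> x0 xN; rewrite /gain /stationary_gain.
have -> : (1 + beta) ^+ 2 - (1 + beta - alpha * x) ^+ 2 =
   alpha ^+ 2 * (x * (m + L - x)).
  by rewrite /alpha /beta /L; field; rewrite c1N kcN m0N.
rewrite tuning_1Bbeta tuning_1Dbeta /alpha /extreme_gain.
move: xN; rewrite /L => xN.
by field; rewrite ?c0N ?c1N ?k0N ?kcN ?kc2N ?m0N ?x0 ?xN.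
Qed.

Lemma tuning_gain_le x : m <= x <= L -> gain x <= extreme_gain.
Proof.
move=> /andP[mx xL].
have x0 : 0 < x by exact: lt_le_trans mx.
have xL0 : 0 < m + L - x by rewrite -addrA ltr_wpDr // subr_ge0.
rewrite tuning_gainE ?gt_eqF // ler_pdivrMr ?mulr_gt0 //.
rewrite ler_wpM2l //.
  have [[c0' k0'] m0'] := (ltW c0, ltW k0, ltW m0).
  by rewrite /extreme_gain !(mulr_ge0, invr_ge0, addr_ge0, sqr_ge0).
rewrite -subr_ge0 (_ : _ - _ = (x - m) * (L - x)); last by ring.
by rewrite mulr_ge0 // subr_ge0.
Qed.

Lemma tuning_gain_mid : gain ((m + L) / 2) = middle_gain.
Proof.
have mL : m + L != 0 by rewrite gt_eqF // addr_gt0 // mulr_gt0.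
have mL2 : (m + L) / 2 != 0 by rewrite mulf_neq0 // invr_neq0 // pnatr_eq0.
have half : m + L - (m + L) / 2 = (m + L) / 2 by field.
rewrite tuning_gainE ?half // /extreme_gain /middle_gain /L.
have -> : m + k * m = (k + 1) * m by ring.
by field; rewrite ?c0N ?k0N ?kc2N ?m0N ?k1N.
Qed.

Lemma extreme_gain_settling : c <= k ->
  extreme_gain * Ts <= k * (k + 1) / 2.
Proof.
move=> ck; rewrite -subr_ge0.
have -> : k * (k + 1) / 2 - extreme_gain * Ts =
  (k + 1) * (16 * k ^+ 2 * c * (k + c ^+ 2) - (c + 1) ^+ 3 * (k + c) ^+ 2) /
  (32 * c * k * (k + c ^+ 2)).
  by rewrite /extreme_gain /Ts; field; rewrite kc2N c0N k0N.
rewrite divr_ge0 //; last by rewrite !mulr_ge0 // ltW.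
apply: mulr_ge0; first by rewrite addr_ge0 // ltW.
rewrite subr_ge0.
rewrite (_ : _ * _ ^+ 2 = ((c + 1) ^+ 2 * (k + c) ^+ 2) * (c + 1)); last by ring.
(* The squares are bounded by [c + 1 <= 2 c] and [k + c <= 2 k]; what is left,
   [c (c + 1) <= k + c^2], is [c <= k] again. *)
apply: (@le_trans _ _ ((4 * c ^+ 2 * (4 * k ^+ 2)) * (c + 1))).
  rewrite ler_wpM2r ?addr_ge0 ?(ltW c0) // ler_pM ?sqr_ge0 //.
    rewrite -subr_ge0 (_ : _ - _ = (c - 1) * (3 * c + 1)); last by ring.
    by rewrite mulr_ge0 ?subr_ge0 ?addr_ge0 ?mulr_ge0 // ltW.
  rewrite -subr_ge0 (_ : _ - _ = (k - c) * (3 * k + c)); last by ring.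
  by rewrite mulr_ge0 ?subr_ge0 ?addr_ge0 ?mulr_ge0 // ltW.
rewrite -subr_ge0 (_ : _ - _ = 16 * k ^+ 2 * c * (k - c)); last by ring.
by rewrite !mulr_ge0 ?sqr_ge0 ?subr_ge0 // ltW.
Qed.

(** With two extreme modes, [n - 2] midpoint modes bounded by [k] give
    [k (k + 1) + (n - 2) k = k (k + n - 1)]. *)
Lemma middle_gain_settling : c <= k -> middle_gain * Ts <= k.
Proof.
move=> ck; rewrite -subr_ge0.
have -> : k - middle_gain * Ts =
  (8 * c * k * (k + 1) * (k + c ^+ 2) - (c + 1) ^+ 3 * (k + c) ^+ 2) /
  (8 * c * (k + 1) * (k + c ^+ 2)).
  by rewrite /middle_gain /Ts; field; rewrite kc2N c0N k1N.
rewrite divr_ge0 //; last by rewrite !mulr_ge0 ?addr_ge0 // ?sqr_ge0 // ltW.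
(* Taylor expansion at [k = c] *)
set u := k - c.
have u0 : 0 <= u by rewrite subr_ge0.
rewrite (_ : _ - _ = 4 * c ^+ 2 * (c + 1) ^+ 2 * (c - 1)
   + (12 * c ^+ 4 + 20 * c ^+ 3 + 4 * c * (c - 1)) * u
   + (7 * c ^+ 3 + 21 * c ^+ 2 + 4 * c + (c - 1)) * u ^+ 2
   + 8 * c * u ^+ 3); last by rewrite /u; ring.
have c0' := ltW c0.
have : 0 <= c - 1 by rewrite subr_ge0 ltW.
move: (c - 1) u u0 => t u u0 t0.
by rewrite !(addr_ge0, mulr_ge0, exprn_ge0).
Qed.

(** Here [alpha ^+ 2] cancels the factor [(c + 1) ^+ 2 * (k + c) ^+ 2] of the gain, leaving
    [c (c + 1) <= 2 (k + c^2)]. This holds for all [c > 1], so the bound covers every admissible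
    rate. *)
Lemma extreme_gain_gradient_settling :
  alpha ^+ 2 * extreme_gain * Ts <= k * (k + 1) / L ^+ 2.
Proof.
rewrite -subr_ge0.
have -> : k * (k + 1) / L ^+ 2 - alpha ^+ 2 * extreme_gain * Ts =
   k * (k + 1) / L ^+ 2 * ((2 * k + c * (c - 1)) / (2 * (k + c ^+ 2))).
  rewrite /extreme_gain /alpha /L /Ts; field.
  by rewrite ?c0N ?c1N ?k0N ?kcN ?kc2N ?m0N.
have [[c0' k0'] m0'] := (ltW c0, ltW k0, ltW m0).
have : 0 <= c - 1 by rewrite subr_ge0 ltW.
move: (c - 1) => t t0.
by rewrite !(mulr_ge0, invr_ge0, addr_ge0, sqr_ge0).
Qed.

(** With two extreme modes, [n - 2] terms of this size give [2 k (k + 1) + 8 k (n - 2) = 2 k (k + 4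
    n - 7)], up to [L ^+ 2]. *)
Lemma middle_gain_gradient_settling :
  alpha ^+ 2 * middle_gain * Ts <= 8 * k / L ^+ 2.
Proof.
rewrite -subr_ge0.
have -> : 8 * k / L ^+ 2 - alpha ^+ 2 * middle_gain * Ts =
   2 * k / L ^+ 2 * ((4 * k * (k + 1) + 4 * c ^+ 2 + 2 * k * c ^+ 2
      + k * c * (c - 1)) / ((k + 1) * (k + c ^+ 2))).
  rewrite /middle_gain /alpha /L /Ts; field.
  by rewrite ?c0N ?c1N ?k0N ?kcN ?kc2N ?m0N ?k1N.
have [[c0' k0'] m0'] := (ltW c0, ltW k0, ltW m0).
have : 0 <= c - 1 by rewrite subr_ge0 ltW.
move: (c - 1) => t t0.
by rewrite !(mulr_ge0, invr_ge0, addr_ge0, sqr_ge0).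
Qed.

End Tuning.

(** * Spectra of matrices in the class, and its diagonal members *)

Section QmLMatrices.
Variable R : realType.

Lemma in_QmL_unitmx n (m L : R) (Q : 'M[R]_n) : 0 < m -> in_QmL m L Q ->
  Q \in unitmx.
Proof.
move=> m0 [_ _ _ [_ Hm]]; rewrite -row_free_unit -kermx_eq0.
apply: contraT => /rowV0Pn [v /sub_kermxP vQ v0].
have : eigenvalue Q 0 by apply/eigenvalueP; exists v; rewrite // vQ scale0r.
by move/Hm; rewrite leNgt m0.
Qed.

Lemma eigenvalue_diag_mx n (D : 'rV[R]_n) a :
  eigenvalue (diag_mx D) a <-> exists i, a = D 0 i.
Proof.
split=> [/eigenvalueP [v va /rV0Pn [i vi]]|[i ->]].
  exists i; move/rowP/(_ i): va; rewrite mul_mx_diag !mxE mulrC.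
  by move/(mulIf vi) => ->.
apply/eigenvalueP; exists (delta_mx 0 i).
  apply/rowP => j; rewrite mul_mx_diag !mxE eqxx /=.
  by case: eqVneq => [->|]; rewrite ?mul1r ?mulr1 ?mul0r ?mulr0.
by apply/rV0Pn; exists i; rewrite mxE !eqxx oner_eq0.
Qed.

Lemma diag_mx_eigenframe n (D : 'rV[R]_n) :
  eigenframe (diag_mx D) 1%:M (fun i => D 0 i).
Proof.
split=> [l|l|]; last by rewrite trmx1 mul1mx.
  apply/rowP => j; rewrite mul_mx_diag !mxE.
  by case: eqVneq => [->|]; rewrite ?mul1r ?mulr1 ?mul0r ?mulr0.
by apply/eigenvalue_diag_mx; exists l.
Qed.

Lemma diag_mx_in_QmL n (D : 'rV[R]_n) (m L : R) i j :
  0 < m -> (forall l, m <= D 0 l <= L) -> D 0 i = m -> D 0 j = L ->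
  in_QmL m L (diag_mx D).
Proof.
move=> m0 HD Di Dj; split.
- exact: tr_diag_mx.
- move=> x /cV0Pn [l xl].
  rewrite mul_mx_diag mxE (bigD1 l) //= !mxE ltr_wpDr //.
    apply: sumr_ge0 => l' _; rewrite !mxE mulrAC -expr2 mulr_ge0 ?sqr_ge0 //.
    by have /andP[/(le_trans (ltW m0))] := HD l'.
  rewrite mulrAC -expr2 mulr_gt0 ?exprn_even_gt0 //.
  by have /andP[/(lt_le_trans m0)] := HD l.
- split; first by apply/eigenvalue_diag_mx; exists j.
  by move=> a /eigenvalue_diag_mx [l ->]; have /andP[] := HD l.
- split; first by apply/eigenvalue_diag_mx; exists i.
  by move=> a /eigenvalue_diag_mx [l ->]; have /andP[] := HD l.
Qed.

(** Trace of [U^T U = 1]: the modal weights add up to the dimension, however many frame vectors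
    there are. *)
Lemma eigenframe_sum_sqr n N (Q : 'M[R]_n) (U : 'M[R]_(N, n)) D :
  eigenframe Q U D -> \sum_l \sum_i U l i ^+ 2 = n%:R.
Proof.
move=> [_ _ UU]; rewrite exchange_big /= -(mxtrace1 R n) -UU.
apply: eq_bigr => i _; rewrite !mxE; apply: eq_bigr => l _.
by rewrite mxE expr2.
Qed.

End QmLMatrices.

(** * Bounds on [Jmax] and [Jmin] for the tuned parameters *)

Section Bounds.
Variables (R : realType) (n : nat) (m k c : R).
Hypotheses (m0 : 0 < m) (k1 : 1 <= k) (c1 : 1 < c) (kc : k <= c ^+ 2).
Context (d : measure_display) (T : measurableType d) (P : probability T R).
Variables (w : nat -> 'I_n -> T -> R) (sigw : R) (x0 x1 : 'cV[R]_n).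
Hypothesis wn : white_noise P w.
Let L := k * m.
Let beta := (c - 1) * (k - c) / ((c + 1) * (k + c)).
Let alpha := 4 * c / ((c + 1) * (k + c) * m).

Lemma tuned_Jmax_le :
  (Jmax P m L alpha beta 0 sigw w x0 x1
     <= (sigw ^+ 2 * (n%:R * extreme_gain k c))%:E)%E.
Proof.
apply: ge_ereal_sup => _ /= [[Q q] /= QmL <-].
have [QT _ [_ QL] [_ Qm]] := QmL.
have [N [U [D frame]]] := sym_eigenframe QT.
have [_ De _] := frame.
have HD l : m <= D l <= L by rewrite QL ?Qm.
rewrite (noise_amp_eigenframe wn sigw q x0 x1 (in_QmL_unitmx m0 QmL) frame
  (tuning_rho01 c1) (tuning_beta_le k1 c1 kc)); last first.
  by move=> l; exact: tuning_stable.
rewrite lee_fin.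
have -> : sigw ^+ 2 * (n%:R * extreme_gain k c) =
   \sum_l extreme_gain k c * (sigw ^+ 2 * \sum_i U l i ^+ 2).
  by rewrite -!mulr_sumr (eigenframe_sum_sqr frame); ring.
apply: ler_sum => l _; rewrite ler_wpM2r //.
  by rewrite mulr_ge0 ?sqr_ge0 // sumr_ge0 // => i _; rewrite sqr_ge0.
exact: tuning_gain_le.
Qed.

Lemma tuned_Jmin_le : (1 < n)%N ->
  (Jmin P m L alpha beta 0 sigw w x0 x1
     <= (sigw ^+ 2 * (2 * extreme_gain k c + (n%:R - 2) * middle_gain k c))%:E)%E.
Proof.
move=> n2.
pose i0 : 'I_n := Ordinal (ltnW n2); pose i1 : 'I_n := Ordinal n2.
(* The class forces the eigenvalues [m] and [L]; all others are put at the midpoint, where the gain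
   is smallest. *)
pose D : 'rV[R]_n :=
  \row_i (if i == i0 then m else if i == i1 then L else (m + L) / 2).
have mL : m <= L by rewrite /L ler_peMl // ltW.
have HD l : m <= D 0 l <= L.
  rewrite mxE; case: ifP => _; [|case: ifP => _]; rewrite ?lexx ?mL //.
  by rewrite ler_pdivlMr // ler_pdivrMr //; apply/andP; split; move: mL; lra.
have i10 : i1 != i0 by [].
have QmL : in_QmL m L (diag_mx D).
  by apply: (@diag_mx_in_QmL _ _ _ _ _ i0 i1) => //; rewrite mxE ?eqxx // (negbTE i10) eqxx.
apply: le_trans.
  by apply: ereal_inf_lbound; exists (diag_mx D, 0).
rewrite /= (noise_amp_eigenframe wn sigw 0 x0 x1 (in_QmL_unitmx m0 QmL)
  (diag_mx_eigenframe D) (tuning_rho01 c1) (tuning_beta_le k1 c1 kc)); last first.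
  by move=> l; exact: tuning_stable.
rewrite lee_fin.
have sq1 l : \sum_i (1%:M : 'M[R]_n) l i ^+ 2 = 1.
  rewrite (bigD1 l) //= big1 => [|j jl]; first by rewrite mxE eqxx expr1n addr0.
  by rewrite mxE eq_sym (negbTE jl) expr0n.
under eq_bigr do rewrite sq1 mulr1 mulrC.
rewrite -mulr_sumr ler_wpM2l ?sqr_ge0 //.
rewrite (bigD1 i0) //= (bigD1 i1) //= addrA lerD //.
  by rewrite mulr_natl mulr2n lerD // tuning_gain_le.
rewrite (eq_bigr (fun=> middle_gain k c)).
  rewrite sumr_const (_ : #|_| = (n - 2)%N); last first.
    have := cardC (pred2 i0 i1); rewrite card2 card_ord eq_sym i10 /= => cE.
    rewrite -[X in (X - 2)%N]cE addKn.
    by apply: eq_card => l; rewrite !inE negb_or.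
  by rewrite -[leLHS]mulr_natl natrB.
move=> l /andP[l0 l1]; rewrite mxE (negbTE l0) (negbTE l1).
exact: tuning_gain_mid.
Qed.
End Bounds.

(** * Passage from [rho] and [L] to the variables [c] and [kappa] *)

Theorem theorem3 (R : realType) (n : nat) (m L rho : R) :
  (1 <= n)%N -> 0 < m -> m <= L -> 0 < rho < 1 ->
  let kappa := L / m in
  let Ts := (1 - rho)^-1 in
  (Num.sqrt kappa + 1) / 2 <= Ts ->
  let c := (1 + rho) / (1 - rho) in
  let beta := rho * ((kappa - c) / (kappa + c)) in
  let alpha := (1 + rho) * (1 + beta / rho) / L in
  let gamma := 0 in
  [/\
   (* linear convergence with rate rho for all f in Q_m^L *)
   converges_linearly_QmL n m L alpha beta gamma rho,
   (* general noise level sigma_w (iterate model: sigma_w = sigma; gradient model: sigma_w = alpha sigma) *)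
   Ts <= (kappa + 1) / 2 ->
   forall sigw : R, 0 < sigw ->
   forall (d : measure_display) (T : measurableType d) (P : probability T R)
          (w : nat -> 'I_n -> T -> R),
   white_noise P w ->
   forall x0 x1 : 'cV[R]_n,
     (Jmax P m L alpha beta gamma sigw w x0 x1 * Ts%:E
        <= (sigw ^+ 2 * (n%:R * kappa * (kappa + 1) / 2))%:E)%E
     /\ ((1 < n)%N ->
         (Jmin P m L alpha beta gamma sigw w x0 x1 * Ts%:E
            <= (sigw ^+ 2 * (kappa * (kappa + n%:R - 1)))%:E)%E)
  & (* gradient noise model sigma_w = alpha sigma, any admissible rho *)
   forall sigma : R, 0 < sigma ->
   forall (d : measure_display) (T : measurableType d) (P : probability T R)
          (w : nat -> 'I_n -> T -> R),
   white_noise P w ->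
   forall x0 x1 : 'cV[R]_n,
     (Jmax P m L alpha beta gamma (alpha * sigma) w x0 x1 * Ts%:E
        <= (sigma ^+ 2 * (n%:R * kappa * (kappa + 1)) / L ^+ 2)%:E)%E
     /\ ((1 < n)%N ->
         (Jmin P m L alpha beta gamma (alpha * sigma) w x0 x1 * Ts%:E
            <= (sigma ^+ 2 * (2 * kappa * (kappa + 4 * n%:R - 7)) / L ^+ 2)%:E)%E)].
Proof.
move=> n1 m0 mL rho01 kappa Ts HTs c beta alpha gamma.
have /andP[rho0 rho1] := rho01.
have r1 : 0 < 1 - rho by rewrite subr_gt0.
have r1N : 1 - rho != 0 by rewrite gt_eqF.
have k1 : 1 <= kappa by rewrite ler_pdivlMr // mul1r.
have c1 : 1 < c by rewrite ltr_pdivlMr //; lra.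
have kc0 : kappa + c != 0 by rewrite gt_eqF //; lra.
have c10 : c + 1 != 0 by rewrite gt_eqF //; lra.
have LE : L = kappa * m by rewrite /kappa divfK // gt_eqF.
have TsE : Ts = (c + 1) / 2 by rewrite /Ts /c; field.
(* As [Ts = (c + 1) / 2], the hypothesis [HTs] says that the square root of [kappa] is at most
   [c]. *)
have kc : kappa <= c ^+ 2.
  rewrite -(sqr_sqrtr (le_trans ler01 k1)) ler_pXn2r ?nnegrE ?sqrtr_ge0 //; lra.
have rhoE : rho = (c - 1) / (c + 1).
  by rewrite /c; field; rewrite r1N; lra.
have betaE : beta = (c - 1) * (kappa - c) / ((c + 1) * (kappa + c)).
  by rewrite /beta rhoE; field; rewrite c10 kc0.
have alphaE : alpha = 4 * c / ((c + 1) * (kappa + c) * m).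
  have brE : beta / rho = (kappa - c) / (kappa + c).
    by rewrite /beta; field; rewrite kc0 gt_eqF.
  rewrite /alpha brE rhoE LE; field.
  by rewrite c10 kc0 !gt_eqF //; lra.
have Ts0 : 0 < Ts by rewrite invr_gt0.
(* [J] may be infinite: for [n = 1] and [m < L] the class is empty and [Jmax] is minus infinity. *)
have gain_times (J : \bar R) (x y : R) :
    (J <= x%:E)%E -> x * Ts <= y -> (J * Ts%:E <= y%:E)%E.
  move=> Jx xy; apply: (@le_trans _ _ (x%:E * Ts%:E)%E).
    by rewrite lee_pmul2r // lte_fin.
  by rewrite -EFinM lee_fin.
have bs s : 0 <= s ^+ 2 :> R by exact: sqr_ge0.
have n2R : (1 < n)%N -> 0 <= n%:R - 2 :> R by move=> n2; rewrite subr_ge0 ler_nat.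
have nR : 0 <= n%:R :> R by [].
split.
- move=> Q [QT _ [_ QL] [_ Qm]].
  apply: momentum_spectral_radius_le => //.
  + by rewrite alphaE gt_eqF // tuning_alpha_gt0.
  + by rewrite betaE rhoE tuning_beta_le.
  + move=> x ex; rewrite betaE alphaE rhoE; apply: tuning_stable => //.
    by rewrite -LE QL ?Qm.
- move=> HTs2 sigw sigw0 d T P w wn x0 x1.
  have ck : c <= kappa by move: HTs2; rewrite TsE; lra.
  have He := extreme_gain_settling k1 c1 ck.
  have Hm := middle_gain_settling k1 c1 ck.
  rewrite -TsE in He Hm; rewrite betaE alphaE LE /gamma; split=> [|n2].
    apply: (gain_times _ _ _ (tuned_Jmax_le m0 k1 c1 kc sigw x0 x1 wn)).
    rewrite -mulrA ler_wpM2l // -mulrA.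
    by rewrite -[leRHS]mulrA -[leRHS]mulrA ler_wpM2l // mulrA.
  apply: (gain_times _ _ _ (tuned_Jmin_le m0 k1 c1 kc sigw x0 x1 wn n2)).
  rewrite -mulrA ler_wpM2l //.
  have := ler_wpM2l (n2R n2) Hm; move: He; lra.
- move=> sigma sigma0 d T P w wn x0 x1.
  have He := extreme_gain_gradient_settling m0 k1 c1.
  have Hm := middle_gain_gradient_settling m0 k1 c1.
  rewrite -TsE -alphaE -LE in He Hm.
  split=> [|n2].
    have := tuned_Jmax_le m0 k1 c1 kc (alpha * sigma) x0 x1 wn.
    rewrite -betaE -alphaE -LE => /gain_times; apply.
    have := ler_wpM2l (bs sigma) (ler_wpM2l nR He).
    by congr (_ <= _); ring.
  have := tuned_Jmin_le m0 k1 c1 kc (alpha * sigma) x0 x1 wn n2.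
  rewrite -betaE -alphaE -LE => /gain_times; apply.
  have := ler_wpM2l (bs sigma) (lerD (ler_wpM2l (ler0n R 2) He) (ler_wpM2l (n2R n2) Hm)).
  by congr (_ <= _); ring.
Qed.
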